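(* Let $M\ge1$ be an integer, $P,\sigma^2,\beta_1,\beta_2,\alpha_{\rm NCR}>0$, $\varphi_1\in\mathbb{R}$, and let $\mathbf{a}_{2,1}\in\mathbb{C}^M$ have unit-modulus entries. Consider the received signal $$\mathbf{y}_2=\alpha_{\rm NCR}\sqrt{P\beta_1\beta_2}\,\mathbf{a}_{2,1}e^{\mathsf{j}\varphi_1}s+\alpha_{\rm NCR}\sqrt{\beta_2}\,n_1\mathbf{a}_{2,1}+\mathbf{n}_2,$$ where $n_1\sim\mathcal{N}_{\mathbb{C}}(0,\sigma^2)$ and $\mathbf{n}_2\sim\mathcal{N}_{\mathbb{C}}(\mathbf{0},\sigma^2\mathbf{I}_M)$ are independent and $s$ is a unit-power symbol independent of the noises. Then the SNR of $\mathbf{v}^H\mathbf{y}_2$, maximized over nonzero combining vectors $\mathbf{v}\in\mathbb{C}^M$, is attained by maximum-ratio combining $\mathbf{v}=\mathbf{a}_{2,1}$ and equals $$\mathrm{SNR}_{\rm NCR}=\frac{\alpha_{\rm NCR}^2PM\beta_1\beta_2}{\sigma^2\left(1+\alpha_{\rm NCR}^2\beta_2M\right)}.$$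
   Context: $\mathsf{j}$ is the imaginary unit and $(\cdot)^H$ the conjugate transpose. For a received signal $\mathbf{y}=\mathbf{g}s+\mathbf{w}$ with deterministic $\mathbf{g}$, unit-power $s$ and zero-mean noise $\mathbf{w}$ with covariance $\mathbf{K}$, the SNR with combining vector $\mathbf{v}$ is $|\mathbf{v}^H\mathbf{g}|^2/(\mathbf{v}^H\mathbf{K}\mathbf{v})$. The model describes uplink communication assisted by a network-controlled repeater (NCR) with amplification gain $\alpha_{\rm NCR}$. *)

(* Defs.v *)
From HB Require Import structures.
From mathcomp Require Export all_boot all_order all_algebra.
From mathcomp Require Export complex.
From mathcomp Require Export all_classical all_reals all_analysis.

Set Implicit Arguments.
Unset Strict Implicit.
Unset Printing Implicit Defensive.

Export Order.TTheory GRing.Theory Num.Theory.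
Export numFieldNormedType.Exports.

#[export] Set Implicit Arguments.
#[export] Unset Strict Implicit.
#[export] Unset Printing Implicit Defensive.

Local Open Scope classical_set_scope.
Local Open Scope ring_scope.
Local Open Scope complex_scope.
Local Open Scope sesquilinear_scope.

Definition expj {R : realType} (phi : R) : R[i] := cos phi +i* sin phi.

Section ComplexProbability.
Context {d : measure_display} {T : measurableType d} {R : realType}.
Variable Pr : probability T R.

Definition random_vector n (X : T -> 'cV[R[i]]_n) : Prop :=
  forall i, measurable_fun setT (fun t => complex.Re (X t i 0)) /\
            measurable_fun setT (fun t => complex.Im (X t i 0)).

(* Sigma-algebra on T generated by the real and imaginary parts of the
   coordinates of X. *)
Definition sigma_of n (X : T -> 'cV[R[i]]_n) : set (set T) :=
  <<s [set A | exists i (B : set R), measurable B /\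
         (A = (fun t => complex.Re (X t i 0)) @^-1` B \/
          A = (fun t => complex.Im (X t i 0)) @^-1` B)] >>.

Definition independent m n (X : T -> 'cV[R[i]]_m) (Y : T -> 'cV[R[i]]_n)
    : Prop :=
  forall A B, sigma_of X A -> sigma_of Y B ->
    Pr (A `&` B) = (Pr A * Pr B)%E.

(* A complex scalar random variable as a vector of dimension 1. *)
Definition scalar_vec (x : T -> R[i]) : T -> 'cV[R[i]]_1 :=
  fun t => (x t)%:M.

Definition stack m n (X : T -> 'cV[R[i]]_m) (Y : T -> 'cV[R[i]]_n)
    : T -> 'cV[R[i]]_(m + n) :=
  fun t => col_mx (X t) (Y t).

(* X ~ N_C(0, s2 I_n), circularly symmetric: the 2n real and imaginary parts
   are independent centered normal variables of variance s2 / 2 each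
   (the second argument of [normal_prob] is the standard deviation). *)
Definition complex_normal n (X : T -> 'cV[R[i]]_n) (s2 : R) : Prop :=
  random_vector X /\
  forall A B : 'I_n -> set R,
    (forall i, measurable (A i)) -> (forall i, measurable (B i)) ->
    Pr [set t | forall i, A i (complex.Re (X t i 0)) /\ B i (complex.Im (X t i 0))] =
    (\prod_(i < n) (normal_prob 0 (Num.sqrt (s2 / 2)) (A i) *
                    normal_prob 0 (Num.sqrt (s2 / 2)) (B i)))%E.

(* Meaningful when both parts are integrable ([fine] maps infinities to 0). *)
Definition cexpectation (X : T -> R[i]) : R[i] :=
  fine 'E_Pr[fun t => complex.Re (X t)] +i* fine 'E_Pr[fun t => complex.Im (X t)].

Definition zero_mean n (X : T -> 'cV[R[i]]_n) : Prop :=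
  forall i, ('E_Pr[fun t => complex.Re (X t i 0)%R] = 0)%E /\
            ('E_Pr[fun t => complex.Im (X t i 0)%R] = 0)%E.

Definition finite_second_moments n (X : T -> 'cV[R[i]]_n) : Prop :=
  forall i, ('E_Pr[fun t => complex.Re (`|X t i 0|%R ^+ 2)%R] < +oo)%E.

(* E[(X - E X) (X - E X)^H] *)
Definition covariance_mx n (X : T -> 'cV[R[i]]_n) : 'M[R[i]]_n :=
  let m := \col_i cexpectation (fun t => X t i 0) in
  \matrix_(i, j) cexpectation (fun t => ((X t - m) *m (X t - m)^t*) i j).

Definition unit_power (s : T -> R[i]) : Prop :=
  ('E_Pr[fun t => complex.Re (`|s t|%R ^+ 2)%R] = 1)%E.

(* y = g s + w with deterministic g, unit-power s, and zero-mean noise w with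
   finite covariance: the setting in which [snr] is the SNR of v^H y. *)
Definition signal_model n (y : T -> 'cV[R[i]]_n) (g : 'cV[R[i]]_n)
    (s : T -> R[i]) (w : T -> 'cV[R[i]]_n) : Prop :=
  [/\ forall t, y t = s t *: g + w t,
      random_vector (scalar_vec s) /\ unit_power s,
      random_vector w,
      zero_mean w &
      finite_second_moments w].

(* |v^H g|^2 / (v^H K v), with K the covariance of w.  The value lives in R[i];
   the order of R[i] compares only numbers with equal imaginary parts, so an
   inequality with a real number also asserts realness. *)
Definition snr n (g : 'cV[R[i]]_n) (w : T -> 'cV[R[i]]_n) (v : 'cV[R[i]]_n)
    : R[i] :=
  `|(v^t* *m g) 0 0| ^+ 2 / (v^t* *m covariance_mx w *m v) 0 0.

End ComplexProbability.

(* Main.v *)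
Require Import Defs.
From HB Require Import structures.
From mathcomp Require Import ring measurable_realfun.

(** The effective noise w = k n_1 a + n_2, with k = alpha sqrt(beta_2), has
    covariance K = |k|^2 sigma^2 a a^H + sigma^2 I, because all real and
    imaginary parts involved are centered of variance sigma^2 / 2 and pairwise
    uncorrelated. With x = |v^H a|^2 and N = v^H v, the SNR is therefore
    gamma x / (sigma^2 (|k|^2 x + N)), gamma = alpha^2 P beta_1 beta_2. It
    increases with x, and Cauchy-Schwarz bounds x by M N, with equality at
    v = a. *)

Local Open Scope classical_set_scope.
Local Open Scope ring_scope.
Local Open Scope complex_scope.

(** * Moments of the normal distribution *)

Section NormalMoments.
Context {R : realType}.
Variable sigma : R.
Hypothesis sigma0 : sigma != 0.
Notation mu := (@lebesgue_measure R).
Notation phi := (normal_pdf 0 sigma).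

Lemma normal_pdf_even (x : R) : phi (- x) = phi x.
Proof. by rewrite normal_pdfE// /normal_fun !subr0 sqrrN. Qed.

Lemma is_derive_normal_pdf (x : R) :
  is_derive x 1 phi (- (sigma ^- 2 * (x * phi x))).
Proof.
rewrite normal_pdfE// /normal_fun.
apply: is_derive_eq.
rewrite /GRing.scale/= subr0; field.
by rewrite sigma0.
Qed.

(** Integration by parts with factors [x] and [x * phi x], an antiderivative of the latter being
    [- (sigma ^+ 2 * phi x)]. The end [n.+1] keeps the interval nondegenerate. *)
Lemma integral_sqr_normal_pdf_itv (n : nat) :
  (\int[mu]_(x in `[0%R, n.+1%:R]) (x ^+ 2 * phi x)%:E =
   (sigma ^+ 2)%:E * \int[mu]_(x in `[0%R, n.+1%:R]) (phi x)%:E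
   - (sigma ^+ 2 * (n.+1%:R * phi n.+1%:R))%:E)%E.
Proof.
pose G (x : R) : R := - (sigma ^+ 2 * phi x).
have dG x : is_derive (x : R^o) 1 (G : R^o -> R^o) (x * phi x).
  have ? := is_derive_normal_pdf x.
  by apply: is_derive_eq; rewrite /GRing.scale/=; field.
have cphi := @continuous_normal_pdf R 0 sigma sigma0.
have cG : continuous G.
  by move=> x; apply/differentiable_continuous/derivable1_diffP; case: (dG x).
have cid : continuous (fun x : R => x) by move=> x; exact: cvg_id.
under eq_integral do rewrite expr2 -mulrA.
rewrite (@integration_by_parts _ (fun x => x) G (fun=> 1%R) (fun x => x * phi x)%R)//=.
- under eq_integral do rewrite mul1r /G -mulNr EFinM.
  rewrite integralZl//; last first.
    exact: (integrableS measurableT _ _ (integrable_normal_pdf _ _)).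
  rewrite EFinN mulNe oppeK addeC mul0r subr0; congr (_ + _)%E.
  by rewrite /G mulrN mulrCA.
- by apply: continuous_subspaceT => x; exact: cvg_cst.
- split; first by move=> x _; exact: derivable_id.
    exact/cvg_at_right_filter/cid.
  exact/cvg_at_left_filter/cid.
- by move=> x _; rewrite derive1E derive_id.
- apply: continuous_subspaceT => x; apply: cvgM; [exact: cid|exact: cphi].
- split; first by move=> x _; case: (dG x).
    exact/cvg_at_right_filter/cG.
  exact/cvg_at_left_filter/cG.
- by move=> x _; rewrite derive1E; have [] := dG x.
Qed.

(* [expR u >= 1 + u] makes the boundary term of the integration by parts [O(1 / n)]. *)
Lemma cvg_mul_normal_pdf : n.+1%:R * phi n.+1%:R @[n --> \oo] --> 0.
Proof.
apply: (@squeeze_cvgr _ _ _ _ (cst 0)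
  (fun n => (normal_peak sigma * (sigma ^+ 2 *+ 2)) * n.+1%:R^-1)).
- apply: nearW => n /=; rewrite mulr_ge0 ?normal_pdf_ge0//=.
  rewrite normal_pdfE// /normal_fun subr0.
  rewrite mulrCA -mulrA ler_wpM2l ?normal_peak_ge0//.
  rewrite ler_pdivlMr// mulrAC -expr2 mulNr expRN -ler_pdivlMr ?invr_gt0 ?expR_gt0//.
  rewrite invrK; apply: le_trans (ler_wpM2l _ (expR_ge1Dx _)); last first.
    by rewrite mulrn_wge0// sqr_ge0.
  rewrite mulrDr mulr1 mulrC divfK ?lerDr ?mulrn_wge0 ?sqr_ge0//.
  by rewrite mulrn_eq0/= expf_neq0.
- exact: cvg_cst.
- rewrite -[X in _ --> X](mulr0 (normal_peak sigma * (sigma ^+ 2 *+ 2))).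
  apply: cvgM; first exact: cvg_cst.
  exact: cvg_harmonic.
Qed.

Lemma integral0y_normal_pdf :
  (\int[mu]_(x in `[0%R, +oo[) (phi x)%:E = (2^-1)%:E)%E.
Proof.
have := @integral_normal_pdf R 0 sigma.
rewrite ge0_symfun_integralT//=; first last.
- by move=> x; rewrite /= normal_pdf_even.
- exact: continuous_normal_pdf.
- by move=> x; exact: normal_pdf_ge0.
rewrite -set_itvcy => h.
have : ((2^-1)%:E * (2%:E * \int[mu]_(x in `[0%R, +oo[) (phi x)%:E) = (2^-1)%:E)%E.
  by rewrite h mule1.
by rewrite muleA -EFinM mulVf// mul1e.
Qed.

(** Evenness reduces the integral to twice that over the half-line, which is the monotone limit of
    the integrals over bounded intervals. In the truncated formula the boundary term vanishes and
    the mass tends to 1/2. *)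
Lemma integral_sqr_normal_pdf :
  (\int[mu]_x (x ^+ 2 * phi x)%:E = (sigma ^+ 2)%:E)%E.
Proof.
have x2phi_ge0 (x : R) : 0 <= x ^+ 2 * phi x.
  by rewrite mulr_ge0 ?sqr_ge0 ?normal_pdf_ge0.
have cx2phi : continuous (fun x : R => x ^+ 2 * phi x).
  move=> x; apply: cvgM; first exact: exprn_continuous.
  exact: continuous_normal_pdf.
have mx2phi : measurable_fun [set: R] (fun x : R => x ^+ 2 * phi x).
  apply: measurable_funM; first exact: measurable_funX.
  exact: measurable_normal_pdf.
rewrite ge0_symfun_integralT//=; last first.
  by move=> x; rewrite /= normal_pdf_even sqrrN.
rewrite -set_itvcy.
have h1 := @ge0_cvgn_integral R mu _ x2phi_ge0 mx2phi.
have h2 := @ge0_cvgn_integral R mu _ (normal_pdf_ge0 0 sigma) (measurable_normal_pdf 0 sigma).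
rewrite integral0y_normal_pdf in h2.
(* The truncated formula is available for upper end [n.+1], hence the shift of both sequences by
   one. *)
rewrite -cvg_shiftS in h1; rewrite -cvg_shiftS in h2.
have h3 : (\int[mu]_(x in `[0%R, n.+1%:R]) (x ^+ 2 * phi x)%:E @[n --> \oo]
    --> (sigma ^+ 2)%:E * (2^-1)%:E - 0%:E)%E.
  under eq_fun do rewrite integral_sqr_normal_pdf_itv.
  apply: cvgeB => //.
  - exact: cvgeZl.
  - apply: cvg_EFin; first exact: nearW.
    rewrite -[X in _ --> X](mulr0 (sigma ^+ 2)); apply: cvgM; first exact: cvg_cst.
    exact: cvg_mul_normal_pdf.
rewrite (cvg_unique _ h1 h3)// sube0.
by rewrite -!EFinM mulrCA mulfV// mulr1.
Qed.

End NormalMoments.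

(** * Integration against the normal law *)

Section NormalProbIntegral.
Context {R : realType}.
Variable sigma : R.
Hypothesis sigma0 : sigma != 0.
Notation mu := (@lebesgue_measure R).
Notation phi := (normal_pdf 0 sigma).
Local Open Scope ereal_scope.

(** Change of variables yields the Radon-Nikodym derivative of [normal_prob] in place of [phi]. The
    two agree almost everywhere because they have the same integral over every measurable set. *)
Lemma ge0_integral_normal_prob (f : R -> \bar R) :
  measurable_fun [set: R] f -> (forall x, 0 <= f x) ->
  \int[normal_prob 0 sigma]_x f x = \int[mu]_x (f x * (phi x)%:E).
Proof.
move=> mf f0.
have dom := @normal_prob_dominates R 0 sigma.
rewrite -(Radon_Nikodym_SigmaFinite.change_of_variables dom)//.
have mRN := measurable_int _ (Radon_Nikodym_SigmaFinite.f_integrable dom).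
have mphi : measurable_fun [set: R] (EFin \o phi).
  by apply/measurable_EFinP; exact: measurable_normal_pdf.
apply: ge0_ae_eq_integral => //.
- exact: emeasurable_funM.
- exact: emeasurable_funM.
- by move=> x _; rewrite mule_ge0// Radon_Nikodym_SigmaFinite.f_ge0.
- by move=> x _; rewrite mule_ge0// lee_fin normal_pdf_ge0.
apply: ae_eqe_mul2l.
apply: integral_ae_eq => //.
- exact: Radon_Nikodym_SigmaFinite.f_integrable.
- by move=> A _ mA; rewrite -Radon_Nikodym_SigmaFinite.f_integral.
Qed.

(** Lebesgue measure is its own pushforward under negation. *)
Lemma ge0_integral_comp_oppr (f : R -> R) :
  (forall x, 0 <= f x)%R -> measurable_fun [set: R] f ->
  \int[mu]_x (f (- x)%R)%:E = \int[mu]_x (f x)%:E.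
Proof.
move=> f0 mf'.
have mf : measurable_fun [set: measurableTypeR R] (EFin \o f) by exact/measurable_EFinP.
have mN : measurable_fun [set: measurableTypeR R] (-%R : R -> measurableTypeR R).
  exact: measurable_funN.
rewrite -[LHS](@ge0_integral_pushforward _ _ _ (measurableTypeR R) R _ mN mu setT _ measurableT mf)//=.
  by apply: eq_measure_integral => //= A mA _; exact: lebesgue_measureN.
by move=> x _; rewrite lee_fin.
Qed.

End NormalProbIntegral.

(** * Real normal random variables *)

Section NormalRV.
Context {d : measure_display} {T : measurableType d} {R : realType}.
Variables (Pr : probability T R) (sigma : R) (X : T -> R).
Hypothesis sigma0 : sigma != 0.
Hypothesis mX : measurable_fun [set: T] X.
Hypothesis X_normal : forall A, measurable A -> Pr (X @^-1` A) = normal_prob 0 sigma A.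
Notation mu := (@lebesgue_measure R).
Notation phi := (normal_pdf 0 sigma).
Local Open Scope ereal_scope.

Lemma ge0_integral_normal_rv (f : R -> R) :
  measurable_fun [set: R] f -> (forall x, 0 <= f x)%R ->
  \int[Pr]_t (f (X t))%:E = \int[mu]_x (f x * phi x)%:E.
Proof.
move=> mf f0.
have mf' : measurable_fun [set: R] (EFin \o f) by exact/measurable_EFinP.
have f0' x : 0 <= (EFin \o f) x by rewrite lee_fin.
under [RHS]eq_integral do rewrite EFinM.
rewrite -[RHS](ge0_integral_normal_prob sigma mf' f0').
(* The codomain is retyped to [measurableTypeR R], over which the law of [X] and [normal_prob] are
   then compared. *)
have mX' : measurable_fun [set: T] (X : T -> measurableTypeR R) by exact: mX.
pose Y : {mfun T >-> measurableTypeR R} :=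
  HB.pack (X : T -> measurableTypeR R) (isMeasurableFun.Build _ _ _ _ _ mX').
rewrite -[LHS](@ge0_integral_distribution _ _ _ _ _ Pr Y (EFin \o f))//.
by apply: (@eq_measure_integral _ (measurableTypeR R)) => A mA _; exact: X_normal.
Qed.

Lemma normal_rv_expectation_sqr : 'E_Pr[(fun t => X t ^+ 2)%R] = (sigma ^+ 2)%:E.
Proof.
rewrite unlock (@ge0_integral_normal_rv (fun x => x ^+ 2)%R).
- exact: integral_sqr_normal_pdf.
- exact: measurable_funX.
- by move=> x; exact: sqr_ge0.
Qed.

Lemma normal_rv_Lfun2 : X \in Lfun Pr 2%:E.
Proof.
rewrite inE; apply/andP; split; rewrite inE//=.
have := normal_rv_expectation_sqr; rewrite unlock /finite_norm => h.
rewrite unlock/= poweR_lty//.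
under eq_integral do rewrite powR_mulrn// -normrX ger0_norm ?sqr_ge0//.
by rewrite h ltry.
Qed.

(** The density is even, so the substitution of [- x] for [x] shows that the positive and negative
    parts of [X] have equal integrals. Integrability makes this common value finite, so the
    difference is 0. *)
Lemma normal_rv_expectation : 'E_Pr[X] = 0.
Proof.
have intX : Pr.-integrable setT (EFin \o X).
  apply/Lfun1_integrable; apply: Lfun_subset12 normal_rv_Lfun2.
  exact: fin_num_measure.
rewrite unlock.
have pos_part : \int[Pr]_t (Num.max (X t) 0%R)%:E = \int[Pr]_t (Num.max (- X t) 0%R)%:E.
  have mmax : measurable_fun [set: R] (fun x => Num.max x 0)%R by exact: measurable_maxr.
  have mmaxN : measurable_fun [set: R] (fun x => Num.max (- x) 0)%R.
    by apply: measurable_maxr => //; exact: measurable_funN.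
  have max_ge0 (x : R) : (0 <= Num.max x 0)%R by rewrite le_max lexx orbT.
  rewrite (ge0_integral_normal_rv mmax)// (ge0_integral_normal_rv mmaxN)//.
  rewrite -ge0_integral_comp_oppr.
  - by apply: eq_integral => x _; rewrite normal_pdf_even.
  - by move=> x; rewrite mulr_ge0 ?normal_pdf_ge0.
  - by apply: measurable_funM => //; exact: measurable_normal_pdf.
have fin_neg := integrable_fin_num measurableT (integrable_funeneg measurableT intX).
rewrite integralE -[X in X - _]/(\int[Pr]_t (EFin \o X)^\+ t).
have pE : \int[Pr]_t (EFin \o X)^\+ t = \int[Pr]_t (EFin \o X)^\- t.
  under eq_integral do rewrite funeposE -EFin_max.
  by rewrite pos_part; apply: eq_integral => t _; rewrite funenegE -EFin_max.
by rewrite pE subee.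
Qed.

End NormalRV.

(** * Independence and second moments of complex random vectors *)

Section IndependentProduct.
Context {d : measure_display} {T : measurableType d} {R : realType}.
Variable Pr : probability T R.
Local Open Scope ereal_scope.

(** A common form for two sources of independence: coordinates of two vectors related by
    [independent], and distinct real coordinates of one [complex_normal] vector. *)
Definition rv_independent (X Y : T -> R) : Prop :=
  forall A B : set R, measurable A -> measurable B ->
  Pr (X @^-1` A `&` Y @^-1` B) = Pr (X @^-1` A) * Pr (Y @^-1` B).

(* The law of [(X, Y)] is the product of the marginal laws, so Fubini's theorem applies. *)
Lemma expectation_mul_independent (X Y : T -> R) :
  X \in Lfun Pr 2%:E -> Y \in Lfun Pr 2%:E -> rv_independent X Y ->
  'E_Pr[(X \* Y)%R] = 'E_Pr[X] * 'E_Pr[Y].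
Proof.
move=> X2 Y2 indXY.
have Pfin : Pr setT \is a fin_num by exact: fin_num_measure.
have X1 := Lfun_subset12 Pfin X2; have Y1 := Lfun_subset12 Pfin Y2.
have /Lfun1_integrable XY1 := Lfun2_mul_Lfun1 X2 Y2.
have mX : measurable_fun [set: T] X by exact: set_mem (sub_Lfun_mfun X2).
have mY : measurable_fun [set: T] Y by exact: set_mem (sub_Lfun_mfun Y2).
have mXY : measurable_fun [set: T] (fun t => (X t, Y t)) by exact: measurable_fun_pair.
pose X' : {RV Pr >-> R} := mfun_Sub (mem_set mX).
pose Y' : {RV Pr >-> R} := mfun_Sub (mem_set mY).
pose Z : {RV Pr >-> (R * R)%type} := mfun_Sub (mem_set mXY).
pose f (z : R * R) := (z.1 * z.2)%:E.
have mf : measurable_fun [set: R * R] f.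
  by apply/measurable_EFinP; apply: measurable_funM.
(* A product measure is determined by its values on measurable rectangles, where the claim is the
   independence hypothesis. *)
have lawZ A : measurable A ->
    (distribution Pr X' \x distribution Pr Y') A = distribution Pr Z A.
  by move=> mA; apply: product_measure_unique => // B C mB mC; exact: indXY.
have intf : (distribution Pr X' \x distribution Pr Y').-integrable setT f.
  apply/integrableP; split => //.
  rewrite (eq_measure_integral (distribution Pr Z)); last by move=> A mA _; exact: lawZ.
  rewrite ge0_integral_distribution//; last exact: measurableT_comp.
  by case/integrableP: XY1.
transitivity (\int[distribution Pr X' \x distribution Pr Y']_z f z).
  rewrite (eq_measure_integral (distribution Pr Z)); last by move=> A mA _; exact: lawZ.
  by rewrite integral_distribution// unlock.
rewrite -integral12_prod_meas1//.
have intY : \int[distribution Pr Y']_y y%:E = 'E_Pr[Y].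
  rewrite integral_distribution//; first by rewrite unlock.
  by move/Lfun1_integrable: Y1.
have intX : \int[distribution Pr X']_y y%:E = 'E_Pr[X].
  rewrite integral_distribution//; first by rewrite unlock.
  by move/Lfun1_integrable: X1.
have iY : (distribution Pr Y').-integrable setT (EFin : R -> \bar R).
  apply/integrableP; split => //.
  rewrite ge0_integral_distribution//; last exact: measurableT_comp.
  by move/Lfun1_integrable/integrableP: Y1 => [].
have iX : (distribution Pr X').-integrable setT (EFin : R -> \bar R).
  apply/integrableP; split => //.
  rewrite ge0_integral_distribution//; last exact: measurableT_comp.
  by move/Lfun1_integrable/integrableP: X1 => [].
rewrite /fubini_F /f/=.
transitivity (\int[distribution Pr X']_x (x%:E * 'E_Pr[Y])).
  apply: eq_integral => x _.
  by rewrite -intY -integralZl//; apply: eq_integral => y _; rewrite EFinM.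
by rewrite -(fineK (expectation_fin_num Y1)) integralZr//= intX.
Qed.

End IndependentProduct.

(** * Integrability and expectation of complex random variables *)

Section ComplexMoments.
Context {d : measure_display} {T : measurableType d} {R : realType}.
Variable Pr : probability T R.
Implicit Types (z w : T -> R[i]) (c : R[i]).

Let Pr_fin : Pr setT \is a fin_num. Proof. exact: fin_num_measure. Qed.

(** Stated by parts to match [cexpectation], which integrates the real and imaginary parts
    separately. *)
Definition cLfun (p : \bar R) z : Prop :=
  ((fun t => complex.Re (z t)) \in Lfun Pr p) /\
  ((fun t => complex.Im (z t)) \in Lfun Pr p).

Let mem_ext (S : {pred (T -> R)}) (f g : T -> R) : f =1 g -> f \in S -> g \in S.
Proof. by move=> /funext ->. Qed.

(** The parts of a complex sum, of a multiple by a constant and of a conjugate product are all real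
    combinations of this shape. *)
Lemma Lfun_lincomb (r a b : R) (f g : T -> R) : 1 <= r ->
  f \in Lfun Pr r%:E -> g \in Lfun Pr r%:E ->
  (fun t => a * f t + b * g t) \in Lfun Pr r%:E.
Proof.
move=> r1 /(Lfun_scale a r1) hf /(Lfun_scale b r1) hg.
have -> : (fun t => a * f t + b * g t) = (a \o* f) + (b \o* g).
  by apply/funext => t /=; rewrite !fctE/= mulrC [b * _]mulrC.
exact: rpredD.
Qed.

Lemma expectation_lincomb (a b : R) (f g : T -> R) :
  f \in Lfun Pr 1 -> g \in Lfun Pr 1 ->
  fine 'E_Pr[fun t => a * f t + b * g t] = a * fine 'E_Pr[f] + b * fine 'E_Pr[g].
Proof.
move=> hf hg.
have -> : (fun t => a * f t + b * g t) = (a \o* f) \+ (b \o* g).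
  by apply/funext => t /=; rewrite mulrC [b * _]mulrC.
have hf' := Lfun_scale a (lexx 1) hf; have hg' := Lfun_scale b (lexx 1) hg.
rewrite expectationD// !expectationZl// fineD ?fineM//;
  by rewrite ?fin_numM ?expectation_fin_num.
Qed.

Lemma cLfun_sub z : cLfun 2%:E z -> cLfun 1 z.
Proof. by move=> [? ?]; split; exact: Lfun_subset12. Qed.

Lemma cLfunD r z w : 1 <= r -> cLfun r%:E z -> cLfun r%:E w ->
  cLfun r%:E (fun t => z t + w t).
Proof.
move=> r1 [z1 z2] [w1 w2]; split.
- by apply: (mem_ext _ (Lfun_lincomb 1 1 r1 z1 w1)) => t; case: (z t) (w t) => ? ? [? ?] /=; rewrite !mul1r.
- by apply: (mem_ext _ (Lfun_lincomb 1 1 r1 z2 w2)) => t; case: (z t) (w t) => ? ? [? ?] /=; rewrite !mul1r.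
Qed.

Lemma cLfunZ r c z : 1 <= r -> cLfun r%:E z -> cLfun r%:E (fun t => c * z t).
Proof.
case: c => a b r1 [z1 z2]; split.
- by apply: (mem_ext _ (Lfun_lincomb a (- b) r1 z1 z2)) => t; case: (z t) => ? ? /=; rewrite mulNr.
- by apply: (mem_ext _ (Lfun_lincomb a b r1 z2 z1)) => t; case: (z t) => ? ?.
Qed.

(** Each part is a sum or difference of products of two square-integrable functions, and such
    products are integrable. *)
Lemma cLfunMJ z w : cLfun 2%:E z -> cLfun 2%:E w ->
  cLfun 1 (fun t => z t * (w t)^*).
Proof.
move=> [z1 z2] [w1 w2].
have l := (Lfun2_mul_Lfun1 z1 w1, Lfun2_mul_Lfun1 z1 w2,
           Lfun2_mul_Lfun1 z2 w1, Lfun2_mul_Lfun1 z2 w2).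
split.
- apply: (mem_ext _ (Lfun_lincomb 1 1 (lexx 1) l.1.1.1 l.2)) => t.
  by rewrite /=; case: (z t) (w t) => ? ? [? ?] /=; rewrite !mul1r mulrN opprK.
- apply: (mem_ext _ (Lfun_lincomb 1 (-1) (lexx 1) l.1.2 l.1.1.2)) => t.
  by rewrite /=; case: (z t) (w t) => ? ? [? ?] /=; rewrite !mul1r mulN1r mulrN addrC.
Qed.

Lemma cexpectationD z w : cLfun 1 z -> cLfun 1 w ->
  cexpectation Pr (fun t => z t + w t) = cexpectation Pr z + cexpectation Pr w.
Proof.
move=> [z1 z2] [w1 w2].
have := (expectation_lincomb 1 1 z1 w1, expectation_lincomb 1 1 z2 w2).
rewrite !mul1r => h; apply/eqP; rewrite eq_complex/=; apply/andP; split; apply/eqP.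
- by rewrite -h.1; congr (fine 'E_Pr[_]); apply/funext => t; case: (z t) (w t) => ? ? [? ?] /=; rewrite !mul1r.
- by rewrite -h.2; congr (fine 'E_Pr[_]); apply/funext => t; case: (z t) (w t) => ? ? [? ?] /=; rewrite !mul1r.
Qed.

Lemma cexpectationZ c z : cLfun 1 z ->
  cexpectation Pr (fun t => c * z t) = c * cexpectation Pr z.
Proof.
case: c => a b [z1 z2].
apply/eqP; rewrite eq_complex/=; apply/andP; split; apply/eqP.
- have := expectation_lincomb a (- b) z1 z2; rewrite mulNr => <-.
  by congr (fine 'E_Pr[_]); apply/funext => t; case: (z t) => ? ? /=; rewrite mulNr.
- rewrite -(expectation_lincomb a b z2 z1).
  by congr (fine 'E_Pr[_]); apply/funext => t; case: (z t) => ? ?.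
Qed.

(** Reduces a complex correlation to four real ones, to which independence of real variables
    applies. *)
Lemma cexpectationMJ z w : cLfun 2%:E z -> cLfun 2%:E w ->
  cexpectation Pr (fun t => z t * (w t)^*) =
  (fine 'E_Pr[(fun t => complex.Re (z t)) \* (fun t => complex.Re (w t))] +
   fine 'E_Pr[(fun t => complex.Im (z t)) \* (fun t => complex.Im (w t))]) +i*
  (fine 'E_Pr[(fun t => complex.Im (z t)) \* (fun t => complex.Re (w t))] -
   fine 'E_Pr[(fun t => complex.Re (z t)) \* (fun t => complex.Im (w t))]).
Proof.
move=> [z1 z2] [w1 w2].
apply/eqP; rewrite eq_complex/=; apply/andP; split; apply/eqP.
- have := expectation_lincomb 1 1 (Lfun2_mul_Lfun1 z1 w1) (Lfun2_mul_Lfun1 z2 w2).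
  rewrite !mul1r => <-; congr (fine 'E_Pr[_]); apply/funext => t.
  by rewrite /=; case: (z t) (w t) => ? ? [? ?] /=; rewrite !mul1r mulrN opprK.
- have := expectation_lincomb 1 (-1) (Lfun2_mul_Lfun1 z2 w1) (Lfun2_mul_Lfun1 z1 w2).
  rewrite !mul1r mulN1r => <-; congr (fine 'E_Pr[_]); apply/funext => t.
  by rewrite /=; case: (z t) (w t) => ? ? [? ?] /=; rewrite !mul1r mulN1r mulrN addrC.
Qed.

(** As [fine] also sends infinities to 0, integrability is what allows the zero to be lifted back to
    the extended reals. *)
Lemma expectation_eq0_of_cexpectation z : cLfun 1 z -> cexpectation Pr z = 0 ->
  ('E_Pr[fun t => complex.Re (z t)] = 0)%E /\ ('E_Pr[fun t => complex.Im (z t)] = 0)%E.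
Proof.
move=> [z1 z2] [e1 e2].
by rewrite -(fineK (expectation_fin_num z1)) -(fineK (expectation_fin_num z2)) e1 e2.
Qed.

Lemma cLfun2_sqr_norm z : cLfun 2%:E z ->
  ('E_Pr[fun t => complex.Re (`|z t|%R ^+ 2)%R] < +oo)%E.
Proof.
move=> [z1 z2].
have := Lfun_lincomb 1 1 (lexx 1) (Lfun2_mul_Lfun1 z1 z1) (Lfun2_mul_Lfun1 z2 z2).
move/expectation_fin_num/fin_numPlt/andP => [_].
suff -> : (fun t => complex.Re (`|z t| ^+ 2)) = (fun t =>
    1 * (complex.Re (z t) * complex.Re (z t)) + 1 * (complex.Im (z t) * complex.Im (z t))) by [].
by apply/funext => t; rewrite -add_Re2_Im2/= !mul1r.
Qed.

End ComplexMoments.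

(** * Circularly symmetric complex normal vectors *)

Section ComplexNormal.
Context {d : measure_display} {T : measurableType d} {R : realType}.
Variable Pr : probability T R.

(** The boolean lets the [2n] real coordinates of a vector form one family indexed by
    ['I_n * bool]. *)
Definition cpart (b : bool) (z : R[i]) : R := if b then complex.Im z else complex.Re z.

Lemma measurable_cpart n (X : T -> 'cV[R[i]]_n) b i :
  random_vector X -> measurable_fun [set: T] (fun t => cpart b (X t i 0)).
Proof. by move=> /(_ i)[]; case: b. Qed.

(** The preimages involved are among the generators of [sigma_of X] and [sigma_of Y]. *)
Lemma independent_cpart m n (X : T -> 'cV[R[i]]_m) (Y : T -> 'cV[R[i]]_n) b i c j :
  independent Pr X Y ->
  rv_independent Pr (fun t => cpart b (X t i 0)) (fun t => cpart c (Y t j 0)).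
Proof.
move=> indXY A B mA mB; apply: indXY; apply: sub_gen_smallest.
- by exists i, A; split => //; case: b; [right|left].
- by exists j, B; split => //; case: c; [right|left].
Qed.

Section ComplexNormalVector.
Variables (n : nat) (X : T -> 'cV[R[i]]_n) (s2 : R).
Hypothesis s2_gt0 : 0 < s2.
Hypothesis X_normal : complex_normal Pr X s2.
Notation sd := (Num.sqrt (s2 / 2)).

Let sd_neq0 : sd != 0.
Proof. by rewrite gt_eqF// sqrtr_gt0 divr_gt0. Qed.

Lemma complex_normal_joint (C : 'I_n * bool -> set R) :
  (forall p, measurable (C p)) ->
  Pr [set t | forall p, C p (cpart p.2 (X t p.1 0))] =
  (\prod_p normal_prob 0 sd (C p))%E.
Proof.
move=> mC; have [_ jointX] := X_normal.
rewrite (eq_bigr (fun p => normal_prob 0 sd (C (p.1, p.2)))); last by case.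
rewrite -(pair_bigA _ (fun i b => normal_prob 0 sd (C (i, b))))/=.
(* [big_bool] lists [true], the imaginary part, first; the joint law lists the real part first. *)
under eq_bigr do rewrite big_bool/= muleC.
rewrite -(jointX (fun i => C (i, false)) (fun i => C (i, true)))//.
congr (Pr _); apply/seteqP; split => t /= h; first by move=> i; split; exact: (h (i, _)).
by move=> [i []]; have [] := h i.
Qed.

Lemma complex_normal_marginal p (A : set R) : measurable A ->
  Pr ((fun t => cpart p.2 (X t p.1 0)) @^-1` A) = normal_prob 0 sd A.
Proof.
(* Leaving every other coordinate unconstrained turns its factor in the joint law into 1. *)
move=> mA; pose C q := if q == p then A else setT.
have mC q : measurable (C q) by rewrite /C; case: ifP.
have := complex_normal_joint mC.
rewrite (bigD1 p)//= big1 ?mule1; last first.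
  by move=> q /negPf qp; rewrite /C qp probability_setT.
rewrite {2}/C eqxx => <-; congr (Pr _); apply/seteqP; split => t /=.
  by move=> At q; rewrite /C; case: eqP => // ->.
by move=> /(_ p); rewrite /C eqxx.
Qed.

(** The joint law is applied to the family with [A] at [p], [B] at [q] and the whole line elsewhere,
    so that two factors survive. *)
Lemma complex_normal_independent p q : p != q ->
  rv_independent Pr (fun t => cpart p.2 (X t p.1 0)) (fun t => cpart q.2 (X t q.1 0)).
Proof.
move=> pq A B mA mB; rewrite !complex_normal_marginal//.
pose C r := if r == p then A else if r == q then B else setT.
have mC r : measurable (C r) by rewrite /C; case: ifP => // _; case: ifP.
have := complex_normal_joint mC.
rewrite (bigD1 p)//= (bigD1 q) 1?eq_sym//= big1 ?mule1; last first.
  by move=> r /andP[/negPf rp /negPf rq]; rewrite /C rp rq probability_setT.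
rewrite {2 3}/C !eqxx eq_sym (negPf pq) => <-.
congr (Pr _); apply/seteqP; split => t /=.
  by move=> [At Bt] r; rewrite /C; case: eqP => [->//|_]; case: eqP => [->|].
move=> h; split; first by have := h p; rewrite /C eqxx.
by have := h q; rewrite /C eqxx eq_sym (negPf pq).
Qed.

Lemma complex_normal_Lfun2 p : (fun t => cpart p.2 (X t p.1 0)) \in Lfun Pr 2%:E.
Proof.
have [rX _] := X_normal.
exact: (normal_rv_Lfun2 sd_neq0 (measurable_cpart p.2 p.1 rX) (@complex_normal_marginal p)).
Qed.

Lemma complex_normal_expectation p : ('E_Pr[fun t => cpart p.2 (X t p.1 0%R)] = 0)%E.
Proof.
have [rX _] := X_normal.
exact: (normal_rv_expectation sd_neq0 (measurable_cpart p.2 p.1 rX) (@complex_normal_marginal p)).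
Qed.

Lemma complex_normal_expectation_mul p q :
  ('E_Pr[(fun t => cpart p.2 (X t p.1 0%R)) \* (fun t => cpart q.2 (X t q.1 0%R))] =
   (if p == q then s2 / 2 else 0)%R%:E)%E.
Proof.
have [rX _] := X_normal.
have [<-|pq] := eqVneq p q; last first.
  rewrite expectation_mul_independent ?complex_normal_Lfun2 ?complex_normal_expectation ?mule0//.
  exact: complex_normal_independent.
rewrite -[X in X%:E](@sqr_sqrtr _ (s2 / 2)); last by rewrite ltW// divr_gt0.
exact: (normal_rv_expectation_sqr sd_neq0 (measurable_cpart p.2 p.1 rX) (@complex_normal_marginal p)).
Qed.

Lemma complex_normal_cLfun2 i : cLfun Pr 2%:E (fun t => X t i 0).
Proof. by split; [exact: (complex_normal_Lfun2 (i, false))|exact: (complex_normal_Lfun2 (i, true))]. Qed.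

Lemma complex_normal_mean i : cexpectation Pr (fun t => X t i 0) = 0.
Proof.
rewrite /cexpectation.
by have := (complex_normal_expectation (i, false), complex_normal_expectation (i, true)) => /= -[-> ->].
Qed.

(** On the diagonal the real and imaginary parts contribute [s2 / 2] each; every other real
    correlation is 0. *)
Lemma complex_normal_cov i j :
  cexpectation Pr (fun t => X t i 0 * (X t j 0)^*) = (s2 *+ (i == j))%:C.
Proof.
rewrite cexpectationMJ; [|exact: complex_normal_cLfun2..].
have h b c := complex_normal_expectation_mul (i, b) (j, c).
have := (h false false, h true true, h true false, h false true) => /= -[[[-> ->] ->] ->].
rewrite !xpair_eqE/= !andbT !andbF/= subrr.
by case: (i == j) => /=; rewrite ?addr0// -splitr.
Qed.

End ComplexNormalVector.

(** Independence factors each of the four real correlations into a product of means, and these are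
    0. *)
Lemma complex_normal_cross m n (X : T -> 'cV[R[i]]_m) (Y : T -> 'cV[R[i]]_n) (s2 : R) i j :
  0 < s2 -> complex_normal Pr X s2 -> complex_normal Pr Y s2 -> independent Pr X Y ->
  cexpectation Pr (fun t => X t i 0 * (Y t j 0)^*) = 0.
Proof.
move=> s2_gt0 nX nY indXY.
rewrite cexpectationMJ; [|exact: complex_normal_cLfun2 nX _|exact: complex_normal_cLfun2 nY _].
have h b c : fine 'E_Pr[(fun t => cpart b (X t i 0%R)) \* (fun t => cpart c (Y t j 0%R))] = 0.
  have -> := @expectation_mul_independent _ _ _ Pr _ _ (complex_normal_Lfun2 s2_gt0 nX (i, b))
    (complex_normal_Lfun2 s2_gt0 nY (j, c)) (independent_cpart b i c j indXY).
  by rewrite (complex_normal_expectation s2_gt0 nX (i, b)) mul0e.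
have := (h false false, h true true, h true false, h false true) => /= -[[[-> ->] ->] ->].
by rewrite addr0 subrr.
Qed.

End ComplexNormal.

(** * Cauchy-Schwarz and the SNR quotient *)

Section HermitianProduct.
Local Open Scope sesquilinear_scope.
Local Open Scope ring_scope.
Context {C : numClosedFieldType} {n : nat}.
Implicit Types u v : 'cV[C]_n.

Definition hdot u v : C := (u^t* *m v) 0 0.

Lemma hdotE u v : hdot u v = \sum_i (u i 0)^* * v i 0.
Proof. by rewrite /hdot mxE; apply: eq_bigr => i _; rewrite !mxE. Qed.

Lemma hdotC u v : hdot v u = (hdot u v)^*.
Proof.
rewrite !hdotE rmorph_sum/=; apply: eq_bigr => i _.
by rewrite rmorphM/= conjCK mulrC.
Qed.

(** Gives access to positivity and Cauchy-Schwarz, known for the form [dotmx] on row vectors. *)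
Lemma hdot_dotmx u v : hdot u v = dotmx (u^t*) (v^t*).
Proof. by rewrite dotmxE trmxCK. Qed.

Lemma hdot_gt0 v : v != 0 -> 0 < hdot v v.
Proof.
move=> v0; rewrite hdot_dotmx; apply: dotmx_is_dotmx.
apply: contraNneq v0 => h; rewrite -[v]trmxCK h.
by apply/eqP/matrixP => i j; rewrite !mxE rmorph0.
Qed.

Lemma hdot_CauchySchwarz u v : `|hdot u v| ^+ 2 <= hdot u u * hdot v v.
Proof. by rewrite !hdot_dotmx; exact: (CauchySchwarz (@dotmx C n)). Qed.

Lemma hdot_unimodular (a : 'cV[C]_n) : (forall i, `|a i 0| = 1) -> hdot a a = n%:R.
Proof.
move=> ha; rewrite hdotE (eq_bigr (fun=> 1)); last first.
  by move=> i _; rewrite mulrC -normCK ha expr1n.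
by rewrite sumr_const card_ord.
Qed.

(** The rank-one term factors as [hdot v a * hdot a v], a number times its conjugate. *)
Lemma hdot_rank1_form (a v : 'cV[C]_n) (k s : C) :
  (v^t* *m (k *: (a *m a^t*) + s%:M) *m v) 0 0 = k * `|hdot v a| ^+ 2 + s * hdot v v.
Proof.
rewrite mulmxDr mulmxDl -scalemxAr -scalemxAl mul_mx_scalar -scalemxAl mxE.
rewrite [X in X + _]mxE [X in _ + X]mxE; congr (k * _ + _).
by rewrite (mulmxA (v^t*)) -(mulmxA (v^t* *m a)) mxE big_ord1 -/(hdot v a) -/(hdot a v) (hdotC v a) -normCK.
Qed.

(* [x = |v^H a|^2] and [N = v^H v]: the quotient increases with [x], which is at most [N * A] by Cauchy-Schwarz. *)
Lemma snr_quotient_le (gam kap s x N A : C) :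
  0 <= gam -> 0 <= kap -> 0 < s -> 0 < A -> 0 < N -> 0 <= x -> x <= N * A ->
  gam * x / (kap * s * x + s * N) <= gam * A / (s * (1 + kap * A)).
Proof.
move=> g0 k0 s0 A0 N0 x0 xNA.
have kA0 : 0 < s * (1 + kap * A) by rewrite mulr_gt0// ltr_wpDr// mulr_ge0// ltW.
have D0 : 0 < kap * s * x + s * N by rewrite ltr_wpDl ?mulr_gt0// !mulr_ge0// ltW.
rewrite ler_pdivrMr// mulrAC ler_pdivlMr// -!mulrA ler_wpM2l//.
(* After cross-multiplication both sides contain [s * kap * x * A]; what remains is [x <= N * A]
   scaled by [s]. *)
have -> : x * (s * (1 + kap * A)) = s * x + s * kap * x * A by ring.
have -> : A * (kap * (s * x) + s * N) = s * (N * A) + s * kap * x * A by ring.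
by rewrite lerD2r ler_pM2l.
Qed.

(** The case [v = a], where [x = A ^+ 2] and [N = A]: one factor [A] cancels. *)
Lemma snr_quotient_at (gam kap s A : C) : 0 < A ->
  gam * A ^+ 2 / (kap * s * A ^+ 2 + s * A) = gam * A / (s * (1 + kap * A)).
Proof.
move=> A0; have -> : kap * s * A ^+ 2 + s * A = (s * (1 + kap * A)) * A by ring.
by rewrite expr2 mulrA -mulf_div divff ?mulr1// gt_eqF.
Qed.

End HermitianProduct.

(** * The effective noise *)

Section NoiseCovariance.
Local Open Scope sesquilinear_scope.
Context {d : measure_display} {T : measurableType d} {R : realType}.
Variables (Pr : probability T R) (n : nat).

Lemma covariance_mxE_centered (X : T -> 'cV[R[i]]_n) i j :
  (forall k, cexpectation Pr (fun t => X t k 0) = 0) ->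
  covariance_mx Pr X i j = cexpectation Pr (fun t => X t i 0 * (X t j 0)^*%C).
Proof.
move=> X0; rewrite mxE; congr (cexpectation Pr _); apply/funext => t.
by rewrite mxE big_ord1 !mxE !X0 !subr0.
Qed.

Lemma independentC m (X : T -> 'cV[R[i]]_m) (Y : T -> 'cV[R[i]]_n) :
  independent Pr X Y -> independent Pr Y X.
Proof. by move=> h A B hA hB; rewrite setIC h// muleC. Qed.

Variables (a : 'cV[R[i]]_n) (k : R[i]) (s2 : R).
Variables (n1 : T -> R[i]) (n2 : T -> 'cV[R[i]]_n).
Hypotheses (s2_gt0 : 0 < s2)
  (n1_normal : complex_normal Pr (scalar_vec n1) s2)
  (n2_normal : complex_normal Pr n2 s2)
  (n12_indep : independent Pr (scalar_vec n1) n2).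
Let w t := (k * n1 t) *: a + n2 t.

Let wE i : (fun t => w t i 0) = (fun t => (k * a i 0) * n1 t + n2 t i 0).
Proof. by apply/funext => t; rewrite !mxE mulrAC. Qed.

Let n1E t : scalar_vec n1 t 0 0 = n1 t. Proof. by rewrite mxE eqxx mulr1n. Qed.

Let eq_cexpectation (y z : T -> R[i]) : y =1 z -> cexpectation Pr y = cexpectation Pr z.
Proof. by move=> /funext ->. Qed.

Let n1_L2 : cLfun Pr 2%:E n1.
Proof. by rewrite -(funext n1E); exact: complex_normal_cLfun2 n1_normal _. Qed.

Let n2_L2 i : cLfun Pr 2%:E (fun t => n2 t i 0).
Proof. exact: complex_normal_cLfun2 n2_normal _. Qed.

Let le12 : 1 <= 2 :> R. Proof. by rewrite ler1n. Qed.

Lemma noise_Lfun2 i : cLfun Pr 2%:E (fun t => w t i 0).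
Proof. by rewrite wE; apply: cLfunD => //; exact: cLfunZ. Qed.

Lemma noise_mean i : cexpectation Pr (fun t => w t i 0) = 0.
Proof.
rewrite wE cexpectationD; [|exact/cLfunZ/cLfun_sub|exact: cLfun_sub].
rewrite cexpectationZ; last exact: cLfun_sub.
rewrite -(funext n1E) (complex_normal_mean s2_gt0 n1_normal).
by rewrite (complex_normal_mean s2_gt0 n2_normal) mulr0 addr0.
Qed.

Lemma noise_random_vector : random_vector w.
Proof.
move=> i; have [h1 h2] := noise_Lfun2 i; split;
  [exact: set_mem (sub_Lfun_mfun h1)|exact: set_mem (sub_Lfun_mfun h2)].
Qed.

(** The product of two noise entries expands into four terms. The mixed ones have mean 0 by
    independence; the term in [n1] gives the rank-one part and the term in [n2] the scalar part. *)
Lemma noise_covariance_mx :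
  covariance_mx Pr w = (`|k| ^+ 2 * s2%:C) *: (a *m a^t*) + (s2%:C)%:M.
Proof.
apply/matrixP => i j; rewrite covariance_mxE_centered; last exact: noise_mean.
have -> : (fun t => w t i 0 * (w t j 0)^*%C) =
  (fun t => (k * a i 0 * (k * a j 0)^*%C) * (n1 t * (n1 t)^*%C) +
            (k * a i 0) * (n1 t * (n2 t j 0)^*%C) +
            ((k * a j 0)^*%C * (n2 t i 0 * (n1 t)^*%C) +
            n2 t i 0 * (n2 t j 0)^*%C)).
  apply/funext => t; rewrite (congr1 (@^~ t) (wE i)) (congr1 (@^~ t) (wE j)).
  by rewrite rmorphD !rmorphM/=; ring.
have L11 := cLfunMJ n1_L2 n1_L2.
have L12 := cLfunMJ n1_L2 (n2_L2 j).
have L21 := cLfunMJ (n2_L2 i) n1_L2.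
have L22 := cLfunMJ (n2_L2 i) (n2_L2 j).
have Z c z : cLfun Pr 1 z -> cLfun Pr 1 (fun t => c * z t) by exact: cLfunZ.
rewrite cexpectationD; [|apply: cLfunD => //; exact: Z..|apply: cLfunD => //; exact: Z].
rewrite !cexpectationD//; try exact: Z.
rewrite !cexpectationZ// (complex_normal_cov s2_gt0 n2_normal).
(* [n1] is rewritten as the single coordinate of [scalar_vec n1], so that the facts on normal
   vectors apply. *)
rewrite -(eq_cexpectation (fun t => congr2 (fun x y => x * y^*%C) (n1E t) (n1E t))).
rewrite -(eq_cexpectation (fun t => congr1 (fun x => x * (n2 t j 0)^*%C) (n1E t))).
rewrite -(eq_cexpectation (fun t => congr1 (fun x => n2 t i 0 * x^*%C) (n1E t))).
rewrite (complex_normal_cov s2_gt0 n1_normal) eqxx mulr1n.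
rewrite (complex_normal_cross _ _ s2_gt0 n1_normal n2_normal n12_indep).
rewrite (complex_normal_cross _ _ s2_gt0 n2_normal n1_normal (independentC n12_indep)).
rewrite !mulr0 addr0 add0r !mxE big_ord1 !mxE rmorphMn/=.
by rewrite sqr_normc rmorphM/=; ring.
Qed.

End NoiseCovariance.

(** * The optimal SNR *)

Lemma norm_expj (R : realType) (x : R) : `|expj x| = 1.
Proof. by rewrite normc_def/= cos2Dsin2 sqrtr1. Qed.

Theorem mainTheorem4 (R : realType) (d : measure_display)
    (T : measurableType d) (Pr : probability T R)
    (M : nat) (P sigma2 beta1 beta2 alpha phi1 : R) (a : 'cV[R[i]]_M)
    (s n1 : T -> R[i]) (n2 y2 : T -> 'cV[R[i]]_M)
    (hM : (1 <= M)%N)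
    (hP : 0 < P) (hsigma2 : 0 < sigma2)
    (hbeta1 : 0 < beta1) (hbeta2 : 0 < beta2) (halpha : 0 < alpha)
    (ha : forall i, `|a i 0| = 1)
    (hn1 : complex_normal Pr (scalar_vec n1) sigma2)
    (hn2 : complex_normal Pr n2 sigma2)
    (hn12 : independent Pr (scalar_vec n1) n2)
    (hs : random_vector (scalar_vec s))
    (hs_power : unit_power Pr s)
    (hs_indep : independent Pr (scalar_vec s) (stack (scalar_vec n1) n2))
    (hy2 : forall t, y2 t =
      ((alpha * Num.sqrt (P * beta1 * beta2))%:C * expj phi1 * s t) *: a
      + ((alpha * Num.sqrt beta2)%:C * n1 t) *: a
      + n2 t) :
  let g := ((alpha * Num.sqrt (P * beta1 * beta2))%:C * expj phi1) *: a in
  let w := fun t => ((alpha * Num.sqrt beta2)%:C * n1 t) *: a + n2 t in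
  [/\ signal_model Pr y2 g s w,
      a != 0,
      forall v : 'cV[R[i]]_M, v != 0 -> snr Pr g w v <= snr Pr g w a &
      snr Pr g w a =
        ((alpha ^+ 2 * P * M%:R * beta1 * beta2) /
         (sigma2 * (1 + alpha ^+ 2 * beta2 * M%:R)))%:C].
Proof.
move=> g w; pose k : R[i] := (alpha * Num.sqrt beta2)%:C.
have snrE v : snr Pr g w v =
    (alpha ^+ 2 * P * beta1 * beta2)%:C * `|hdot v a| ^+ 2 /
    ((alpha ^+ 2 * beta2)%:C * sigma2%:C * `|hdot v a| ^+ 2 + sigma2%:C * hdot v v).
  rewrite /snr (noise_covariance_mx a k hsigma2 hn1 hn2 hn12) hdot_rank1_form.
  (* The phase [phi1] drops out here, since [expj phi1] has modulus 1. *)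
  rewrite /g -scalemxAr mxE -/(hdot v a) !normrM norm_expj mulr1 !exprMn.
  have norm2 (x y : R) : 0 <= y -> `|(x * Num.sqrt y)%:C| ^+ 2 = (x ^+ 2 * y)%:C.
    by move=> y0; rewrite -add_Re2_Im2/= expr0n addr0 exprMn sqr_sqrtr.
  rewrite !norm2 ?ltW//; last by rewrite !mulr_gt0.
  by rewrite !mulrA.
have aa := hdot_unimodular ha.
have M_gt0 : 0 < M%:R :> R[i] by rewrite ltr0n.
have s2C : 0 < sigma2%:C by rewrite ltcR.
have kap_ge0 : 0 <= (alpha ^+ 2 * beta2)%:C by rewrite lecR ltW// !mulr_gt0.
have snr_a : snr Pr g w a =
    (alpha ^+ 2 * P * beta1 * beta2)%:C * M%:R /
    (sigma2%:C * (1 + (alpha ^+ 2 * beta2)%:C * M%:R)).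
  by rewrite snrE aa normr_nat snr_quotient_at.
split.
- split.
  + by move=> t; rewrite hy2 /w /g scalerA [s t * _]mulrC addrA.
  + by [].
  + exact: (noise_random_vector a k hsigma2 hn1 hn2).
  + move=> i; apply: expectation_eq0_of_cexpectation.
      exact/cLfun_sub/(noise_Lfun2 a k hsigma2 hn1 hn2).
    exact: (noise_mean a k hsigma2 hn1 hn2).
  + move=> i; apply: cLfun2_sqr_norm.
    exact: (noise_Lfun2 a k hsigma2 hn1 hn2).
(* If [a] were 0, then [M], which equals [hdot a a], would be 0. *)
- apply: contraTneq M_gt0 => a0; rewrite -aa a0 hdotE big1 ?ltxx// => i _.
  by rewrite mxE mulr0.
- move=> v v0; rewrite snr_a snrE; apply: snr_quotient_le => //.
  + by rewrite lecR ltW// !mulr_gt0// exprn_gt0.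
  + exact: hdot_gt0.
  + by rewrite -aa hdot_CauchySchwarz.
- rewrite snr_a !(rmorphM, rmorphD, fmorphV)/= rmorph_nat rmorph1.
  by congr (_ / _); ring.
Qed.
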